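(* Let $f:\mathbb{R}^{n\times p}\to\mathbb{R}$ be differentiable (possibly non-convex) with Lipschitz continuous gradient, and let $\phi=-f$. Let $\beta>0$ and $Y_k,\Lambda_k\in\mathbb{R}^{n\times p}$ be given, and put $D_k=\beta Y_k-\Lambda_k$. Let $r:\mathbb{R}^{n\times p}\to\mathbb{R}$ be convex and define $$g_k(X)=\phi(X)-r(Y_k)-\langle\Lambda_k,X-Y_k\rangle-\frac{\beta}{2}\|X-Y_k\|_F^2 ,$$ $$H(X)=\frac{\partial\phi(X)}{\partial X}X^{T}+X\Big(\frac{\partial\phi(X)}{\partial X}\Big)^{T}+D_kX^{T}+XD_k^{T}-\beta I_n .$$ Then $X\in\mathcal{S}_{n,p}$ satisfies the first order optimality condition of $\max_{X\in\mathcal{S}_{n,p}}g_k(X)$ if and only if both of the following hold: (i) $X$ is a solution of the nonlinear eigenvalue problem with eigenvector dependency, that is, there is a symmetric matrix $\Omega=\Omega^{T}\in\mathbb{R}^{p\times p}$ with $H(X)X=X\Omega$; and (ii) the matrix $X^{T}\big(D_k+\frac{\partial\phi(X)}{\partial X}\big)$ is symmetric.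
   Context: $\mathcal{S}_{n,p}=\{X\in\mathbb{R}^{n\times p}: X^{T}X=I_p\}$ is the Stiefel manifold. $\langle X,Y\rangle=\mathrm{tr}(X^{T}Y)$ and $\|\cdot\|_F$ is the Frobenius norm. For a differentiable function $h$ on $\mathbb{R}^{n\times p}$, $\frac{\partial h(X)}{\partial X}\in\mathbb{R}^{n\times p}$ is the matrix of entrywise partial derivatives, all entries of $X$ being treated as independent. Thus $\frac{\partial g_k(X)}{\partial X}=\frac{\partial\phi(X)}{\partial X}-\Lambda_k-\beta(X-Y_k)$. The gradient of $g_k$ on the Stiefel manifold at $X\in\mathcal{S}_{n,p}$ is $$\mathrm{grad}\,g_k(X)=\frac{\partial g_k(X)}{\partial X}-X\,\mathrm{sym}\Big(X^{T}\frac{\partial g_k(X)}{\partial X}\Big),\qquad \mathrm{sym}(A)=\frac{A+A^{T}}{2}.$$ The first order optimality (KKT) condition of $\max_{X\in\mathcal{S}_{n,p}}g_k(X)$ at $X\in\mathcal{S}_{n,p}$ is $\mathrm{grad}\,g_k(X)=0$, equivalently $\frac{\partial g_k(X)}{\partial X}=X\hat\Omega$ for some symmetric $\hat\Omega\in\mathbb{R}^{p\times p}$. *)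

(* Defs.v *)
From HB Require Import structures.
From mathcomp Require Import all_boot all_order all_algebra.
From mathcomp Require Import all_classical all_reals all_analysis.

Set Implicit Arguments.
Unset Strict Implicit.
Unset Printing Implicit Defensive.

Import Order.TTheory GRing.Theory Num.Theory.
Import numFieldNormedType.Exports.

Local Open Scope classical_set_scope.
Local Open Scope ring_scope.

Definition stiefel (R : realType) (n p : nat) : set 'M[R]_(n, p) :=
  [set X | X^T *m X = 1%:M].
Arguments stiefel : clear implicits.

Definition mxinner (R : realType) (n p : nat) (X Y : 'M[R]_(n, p)) : R :=
  \tr (X^T *m Y).

(* The canonical norm `|X| on matrices is the entrywise
   maximum norm, hence a separate definition. *)
Definition frobenius (R : realType) (n p : nat) (X : 'M[R]_(n, p)) : R :=
  Num.sqrt (mxinner X X).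

(* The (i, j) entry is the derivative of h in the direction of the (i, j)
   elementary matrix, i.e., the partial derivative with respect to X i j. *)
Definition mxgradient (R : realType) (n p : nat) (h : 'M[R]_(n, p) -> R)
    (X : 'M[R]_(n, p)) : 'M[R]_(n, p) :=
  \matrix_(i < n, j < p) 'D_(delta_mx i j) h X.

Definition lipschitz_gradient (R : realType) (n p : nat)
    (h : 'M[R]_(n, p) -> R) : Prop :=
  exists L : R, forall X Y : 'M[R]_(n, p),
    frobenius (mxgradient h X - mxgradient h Y) <= L * frobenius (X - Y).

Definition symmx (R : realType) (p : nat) (A : 'M[R]_p) : 'M[R]_p :=
  2^-1 *: (A + A^T).

Definition stiefel_gradient (R : realType) (n p : nat)
    (h : 'M[R]_(n, p) -> R) (X : 'M[R]_(n, p)) : 'M[R]_(n, p) :=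
  mxgradient h X - X *m symmx (X^T *m mxgradient h X).

(* Meant for X in [stiefel]. *)
Definition stiefel_first_order_optimal (R : realType) (n p : nat)
    (h : 'M[R]_(n, p) -> R) (X : 'M[R]_(n, p)) : Prop :=
  stiefel_gradient h X = 0.

Definition surrogate (R : realType) (n p : nat) (phi r : 'M[R]_(n, p) -> R)
    (beta : R) (Y Lambda X : 'M[R]_(n, p)) : R :=
  phi X - r Y - mxinner Lambda (X - Y) - beta / 2 * frobenius (X - Y) ^+ 2.

Definition nepv_mx (R : realType) (n p : nat) (phi : 'M[R]_(n, p) -> R)
    (beta : R) (D X : 'M[R]_(n, p)) : 'M[R]_n :=
  mxgradient phi X *m X^T + X *m (mxgradient phi X)^T
  + D *m X^T + X *m D^T - beta%:M.

(* Main.v *)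
Require Import Defs.
From mathcomp Require Import all_boot all_order all_algebra.
From mathcomp Require Import all_classical all_reals all_analysis.
From mathcomp Require Import ring.
Import Order.TTheory GRing.Theory Num.Theory.
Import numFieldNormedType.Exports.
Local Open Scope classical_set_scope.
Local Open Scope ring_scope.

(** The Euclidean gradient of the surrogate at [X] is [M - beta *: X] with
    [M := Dk + mxgradient phi X]: along a line the non-[phi] part of the
    surrogate is a quadratic polynomial, so its derivative is its linear
    coefficient ([is_derive_quadratic_along]), and the terms in [Yk] and
    [Lambdak] combine into [Dk].

    After that only linear algebra on [X^T *m X = 1%:M] is left.  The terms in
    [beta] cancel in the Riemannian gradient, so stationarity reads
    [M = X *m symmx (X^T *m M)], that is, [M = X *m S] with [S := X^T *m M]
    symmetric: the column space of [M] lies in that of [X], and [X^T *m M] is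
    symmetric ([stiefel_proj_eq0]).  On the other hand, [nepv_mx] maps [X] to
    [M + X *m M^T *m X - beta *: X] ([nepv_mx_stiefel]).  Once [X^T *m M] is
    symmetric, the last two terms are [X] times a symmetric matrix, so [X]
    solves the eigenvalue problem exactly when [M] is [X] times a symmetric
    matrix; that matrix can only be [X^T *m M]. *)

(** * The Euclidean gradient of the surrogate *)

Lemma mxinnerC (R : realType) (n p : nat) (A B : 'M[R]_(n, p)) :
  mxinner A B = mxinner B A.
Proof. by rewrite /mxinner -mxtrace_tr trmx_mul trmxK. Qed.

Lemma mxinnerDr (R : realType) (n p : nat) (A B C : 'M[R]_(n, p)) :
  mxinner A (B + C) = mxinner A B + mxinner A C.
Proof. by rewrite /mxinner mulmxDr mxtraceD. Qed.

Lemma mxinnerDl (R : realType) (n p : nat) (A B C : 'M[R]_(n, p)) :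
  mxinner (A + B) C = mxinner A C + mxinner B C.
Proof. by rewrite !(mxinnerC _ _ _ _ C) mxinnerDr. Qed.

Lemma mxinnerZr (R : realType) (n p : nat) (a : R) (A B : 'M[R]_(n, p)) :
  mxinner A (a *: B) = a * mxinner A B.
Proof. by rewrite /mxinner -scalemxAr mxtraceZ. Qed.

Lemma mxinnerZl (R : realType) (n p : nat) (a : R) (A B : 'M[R]_(n, p)) :
  mxinner (a *: A) B = a * mxinner A B.
Proof. by rewrite !(mxinnerC _ _ _ _ B) mxinnerZr. Qed.

Lemma mxinner_delta (R : realType) (n p : nat) (A : 'M[R]_(n, p)) i j :
  mxinner A (delta_mx i j) = A i j.
Proof.
rewrite /mxinner /mxtrace (bigD1 j) //= big1 => [|k kj]; rewrite mxE.
  rewrite (bigD1 i) //= big1 => [|l li]; rewrite !mxE ?eqxx ?mulr1 ?addr0 //.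
  by rewrite (negPf li) mulr0.
by rewrite big1 // => l _; rewrite !mxE (negPf kj) andbF mulr0.
Qed.

Lemma frobenius_sqr (R : realType) (n p : nat) (A : 'M[R]_(n, p)) :
  frobenius A ^+ 2 = mxinner A A.
Proof.
rewrite /frobenius sqr_sqrtr // /mxinner /mxtrace.
apply: sumr_ge0 => i _; rewrite mxE; apply: sumr_ge0 => j _.
by rewrite mxE -expr2 sqr_ge0.
Qed.

(** The difference quotient is [a + t * b], which is continuous in [t]. *)
Lemma is_derive_quadratic_along (R : realType) (V : normedModType R)
    (h : V -> R) (x v : V) (a b : R) :
  (forall t : R, h (t *: v + x) = h x + t * a + t ^+ 2 * b) ->
  is_derive x v h a.
Proof.
move=> hE.
suff q : (fun t => t^-1 *: ((h \o shift x) (t *: v) - h x)) @ 0^' --> a.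
  by apply: DeriveDef; [apply: cvgP q | apply: cvg_lim q].
have lin : (fun t : R => a + t * b) @ 0^' --> a.
  rewrite -[X in _ --> X]addr0 -[X in _ --> _ + X](mul0r b).
  apply: cvgD; first exact: cvg_cst.
  apply: cvgMl; exact: nbhs_dnbhs.
apply: cvg_trans lin; apply: near_eq_cvg; near=> t.
have t0 : t != 0 by near: t; exact: nbhs_dnbhs_neq.
rewrite /= hE /GRing.scale /=; field.
exact: t0.
Unshelve. all: by end_near. Qed.

Lemma mxgradient_surrogate (R : realType) (n p : nat)
    (phi r : 'M[R]_(n, p) -> R) (beta : R) (Y Lambda X : 'M[R]_(n, p)) :
  differentiable phi X ->
  mxgradient (surrogate phi r beta Y Lambda) X =
  mxgradient phi X - Lambda - beta *: (X - Y).
Proof.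
move=> dphi; apply/matrixP => i j; rewrite !mxE.
set v := delta_mx i j.
pose q Z := - r Y - mxinner Lambda (Z - Y) - beta / 2 * mxinner (Z - Y) (Z - Y).
have -> : surrogate phi r beta Y Lambda = phi + q.
  by apply/funext => Z; rewrite /surrogate frobenius_sqr /q /= !addrA.
have dq : is_derive X v q
    (- mxinner Lambda v - beta * mxinner (X - Y) v).
  apply: (is_derive_quadratic_along _ _ _ _ _ _ (- (beta / 2) * mxinner v v)).
  move=> t; rewrite /q -addrA !(mxinnerDr, mxinnerDl, mxinnerZr, mxinnerZl).
  by rewrite !(mxinnerC _ _ _ v); field.
have dphiv : derivable phi X v by exact: diff_derivable.
rewrite deriveD //; have [_ ->] := dq.
by rewrite !mxinner_delta !mxE; ring.
Qed.

(** * Linear algebra at an orthonormal frame *)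

Lemma symmx_id (R : realType) (p : nat) (A : 'M[R]_p) : A^T = A -> symmx A = A.
Proof.
move=> AT; rewrite /symmx AT -mulr2n -[A *+ 2]scaler_nat.
by rewrite scalerA mulVf ?scale1r.
Qed.

Lemma symmx_sym (R : realType) (p : nat) (A : 'M[R]_p) : (symmx A)^T = symmx A.
Proof. by rewrite /symmx linearZ linearD /= trmxK addrC. Qed.

(** Multiplying [M = X *m symmx (X^T *m M)] by [X^T] shows that [X^T *m M] is
    its own symmetric part. *)
Lemma stiefel_proj_eq0 (R : realType) (n p : nat) (X M : 'M[R]_(n, p)) :
  stiefel R n p X ->
  M - X *m symmx (X^T *m M) = 0 <->
  M = X *m (X^T *m M) /\ (X^T *m M)^T = X^T *m M.
Proof.
move=> XX; split=> [/eqP|[ME MT]].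
  rewrite subr_eq0 => /eqP ME.
  have SE : X^T *m M = symmx (X^T *m M) by rewrite {1}ME mulmxA XX mul1mx.
  by rewrite SE symmx_sym -ME.
by rewrite symmx_id // -ME subrr.
Qed.

(** A multiple of [X] is normal to the manifold, hence invisible to the
    projection onto the tangent space. *)
Lemma stiefel_proj_normal (R : realType) (n p : nat) (beta : R)
    (X M : 'M[R]_(n, p)) :
  stiefel R n p X ->
  (M - beta *: X) - X *m symmx (X^T *m (M - beta *: X)) =
  M - X *m symmx (X^T *m M).
Proof.
move=> XX; have -> : symmx (X^T *m (M - beta *: X)) =
    symmx (X^T *m M) - beta%:M.
  rewrite mulmxBr -scalemxAr XX scalemx1 -[in RHS](symmx_id _ _ beta%:M).
    by rewrite /symmx -scalerBr linearB /= opprD addrACA.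
  exact: tr_scalar_mx.
by rewrite mulmxBr mul_mx_scalar opprB addrA subrK.
Qed.

Lemma nepv_mx_stiefel (R : realType) (n p : nat) (phi : 'M[R]_(n, p) -> R)
    (beta : R) (D X : 'M[R]_(n, p)) (M := D + mxgradient phi X) :
  stiefel R n p X ->
  nepv_mx phi beta D X *m X = M + X *m (X^T *m M)^T - beta *: X.
Proof.
move=> XX; rewrite /nepv_mx mulmxBl mul_scalar_mx; congr (_ - _).
rewrite trmx_mul trmxK !mulmxDl -!mulmxA XX !mulmx1 /M linearD /= mulmxDl.
by rewrite mulmxDr [D + _]addrC -!addrA; congr (_ + _); rewrite addrC -addrA.
Qed.

Theorem theorem1 (R : realType) (n p : nat)
    (f phi : 'M[R]_(n, p) -> R)
    (f_diff : forall X : 'M[R]_(n, p), differentiable f X)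
    (f_lip : lipschitz_gradient f)
    (phiE : phi = (fun X => - f X))
    (beta : R) (beta_gt0 : 0 < beta)
    (Yk Lambdak Dk : 'M[R]_(n, p))
    (DkE : Dk = beta *: Yk - Lambdak)
    (r : 'M[R]_(n, p) -> R)
    (r_convex : convex_function [set: 'M[R]_(n, p)] r)
    (X : 'M[R]_(n, p)) (X_stiefel : stiefel R n p X) :
  stiefel_first_order_optimal (surrogate phi r beta Yk Lambdak) X <->
  (exists Omega : 'M[R]_p,
      Omega = Omega^T /\ nepv_mx phi beta Dk X *m X = X *m Omega) /\
  (X^T *m (Dk + mxgradient phi X))^T = X^T *m (Dk + mxgradient phi X).
Proof.
have dphi : differentiable phi X.
  by rewrite phiE; apply: differentiableN; exact: f_diff.
rewrite /stiefel_first_order_optimal /stiefel_gradient mxgradient_surrogate //.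
set M := Dk + mxgradient phi X.
have -> : mxgradient phi X - Lambdak - beta *: (X - Yk) = M - beta *: X.
  by rewrite /M DkE scalerBr; apply/matrixP => i j; rewrite !mxE; ring.
rewrite stiefel_proj_normal // stiefel_proj_eq0 // nepv_mx_stiefel // -/M.
set S := X^T *m M; split=> [[ME ST]|[[W [WT WE]] ST]]; split=> //.
  exists (S + S - beta%:M); split.
    by rewrite linearB linearD /= ST tr_scalar_mx.
  by rewrite mulmxBr mulmxDr mul_mx_scalar ST -ME.
have ME : M = X *m (W + beta%:M - S).
  by rewrite mulmxBr mulmxDr mul_mx_scalar -WE subrK ST addrK.
have SE : S = W + beta%:M - S by rewrite {1}/S ME mulmxA X_stiefel mul1mx.
by rewrite SE.
Qed.
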